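(* Let $\mathcal{D}$ be a finite structure. Any two $U$-$X$-cores of $\mathcal{D}$ are isomorphic.
   Context: Structures are finite relational structures with nonempty domain $D$. A shop of $D$ is a map $f$ from $D$ to the power set of $D$ with $f(d)\neq\emptyset$ for all $d$ and $\bigcup_d f(d)=D$; it is a surjective hyper-endomorphism of $\mathcal{D}$ if for each relation $R$ of arity $i$, $R(a_1,\dots,a_i)$ in $\mathcal{D}$ implies $R(b_1,\dots,b_i)$ in $\mathcal{D}$ for all $b_j\in f(a_j)$. For $S\subseteq D$, $f(S)=\bigcup_{s\in S}f(s)$; $f$ is $U$-surjective if $f(U)=D$ and $X$-total if $f(d)\cap X\ne\emptyset$ for every $d\in D$. $U$-$X$-core: choose $U\subseteq D$ of minimum cardinality such that $\mathcal{D}$ has a $U$-surjective surjective hyper-endomorphism and $X\subseteq D$ of minimum cardinality such that $\mathcal{D}$ has an $X$-total surjective hyper-endomorphism, and among all such choices take one with $|U\cap X|$ maximum; the substructure of $\mathcal{D}$ induced by $U\cup X$ is called a $U$-$X$-core of $\mathcal{D}$. *)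

(* Defs.v *)
From mathcomp Require Import all_boot.
Set Implicit Arguments.
Unset Strict Implicit.
Unset Printing Implicit Defensive.

Record signature := Signature {
  symbol : Type;
  arity : symbol -> nat
}.

Record structure (sg : signature) := Structure {
  dom :> finType;
  interp : forall R : symbol sg, {set (arity R).-tuple dom};
  dom_nonempty : 0 < #|dom|
}.
Arguments interp {sg} _ _.

Definition isomorphic (sg : signature) (A B : structure sg) : Prop :=
  exists h : A -> B, bijective h /\
    forall (R : symbol sg) (t : (arity R).-tuple A),
      (t \in interp A R) = (map_tuple h t \in interp B R).

Lemma sub_dom_nonempty (T : finType) (S : {set T}) :
  S != set0 -> 0 < #|{: {x : T | x \in S}}|.
Proof. by move=> S0; rewrite card_sig card_gt0. Qed.

Definition induced (sg : signature) (D : structure sg) (S : {set D})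
    (S0 : S != set0) : structure sg :=
  @Structure sg {x : D | x \in S}
    (fun R => [set t : (arity R).-tuple {x : D | x \in S} |
                 map_tuple val t \in interp D R])
    (sub_dom_nonempty S0).

Definition shop (T : finType) (f : T -> {set T}) : Prop :=
  (forall d, f d != set0) /\ \bigcup_(d : T) f d = [set: T].

Definition she (sg : signature) (D : structure sg) (f : D -> {set D}) : Prop :=
  shop f /\
  forall (R : symbol sg) (a b : (arity R).-tuple D),
    a \in interp D R ->
    (forall j, tnth b j \in f (tnth a j)) ->
    b \in interp D R.

Definition setwise_image (T : finType) (f : T -> {set T}) (S : {set T}) :
    {set T} := \bigcup_(s in S) f s.

Definition U_surjective (T : finType) (U : {set T}) (f : T -> {set T}) : Prop :=
  setwise_image f U = [set: T].

Definition X_total (T : finType) (X : {set T}) (f : T -> {set T}) : Prop :=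
  forall d, f d :&: X != set0.

Definition has_U_surjective_she (sg : signature) (D : structure sg)
    (U : {set D}) : Prop :=
  exists f : D -> {set D}, she f /\ U_surjective U f.

Definition has_X_total_she (sg : signature) (D : structure sg)
    (X : {set D}) : Prop :=
  exists f : D -> {set D}, she f /\ X_total X f.

Definition min_card (T : finType) (P : {set T} -> Prop) (A : {set T}) : Prop :=
  P A /\ forall B : {set T}, P B -> #|A| <= #|B|.

Definition min_UX (sg : signature) (D : structure sg) (U X : {set D}) : Prop :=
  min_card (@has_U_surjective_she sg D) U /\
  min_card (@has_X_total_she sg D) X.

Definition UX_choice (sg : signature) (D : structure sg) (U X : {set D}) :
    Prop :=
  min_UX U X /\
  forall U' X' : {set D}, min_UX U' X' -> #|U' :&: X'| <= #|U :&: X|.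

Lemma UX_choice_neq0 (sg : signature) (D : structure sg) (U X : {set D}) :
  UX_choice U X -> U :|: X != set0.
Proof.
case=> -[[[f [_ fU]] _] _] _; have /card_gt0P[d _] := dom_nonempty D.
have : d \in setwise_image f U by rewrite fU inE.
by case/bigcupP=> u uU _; apply/set0Pn; exists u; rewrite inE uU.
Qed.

Inductive UX_core (sg : signature) (D : structure sg) : structure sg -> Prop :=
  UXCore (U X : {set D}) (UX : UX_choice U X) :
    UX_core D (induced (UX_choice_neq0 UX)).

(* Main.v *)
Require Import Defs.
From mathcomp Require Import all_boot perm fingroup.
Set Implicit Arguments.
Unset Strict Implicit.
Unset Printing Implicit Defensive.

(** Let (U, X) and (U', X') be two optimal choices. A surjective
hyper-endomorphism p that is U-surjective and X'-total restricts, by minimality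
of the cardinalities, to the graph of a bijection a : U -> U' and to that of a
bijection b : X -> X'. Composing with enough turns of a round trip, one finds a
q in the opposite direction that induces the inverses of a and b. If a x <> b x
for some x in both U and X, then q followed by p leads from b x through x to
a x, so that a x can be exchanged for b x in U'; this would enlarge the
intersection of U' and X'. Hence a and b glue to a bijection from U \cup X to
U' \cup X' which is contained in p and whose inverse is contained in q: an
isomorphism. *)

(** * Composition of hyper-operations *)

Definition shop_comp (T : finType) (f g : T -> {set T}) (x : T) : {set T} :=
  setwise_image g (f x).

Lemma mem_shop_comp (T : finType) (f g : T -> {set T}) (x y z : T) :
  y \in f x -> z \in g y -> z \in shop_comp f g x.
Proof. by move=> yfx zgy; apply/bigcupP; exists y. Qed.

Lemma she_comp (sg : signature) (D : structure sg) (f g : D -> {set D}) :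
  she f -> she g -> she (shop_comp f g).
Proof.
move=> [[fN0 fT] fR] [[gN0 gT] gR]; split; first split.
- move=> d; have /set0Pn[y yf] := fN0 d; have /set0Pn[z zg] := gN0 y.
  by apply/set0Pn; exists z; apply: mem_shop_comp zg.
- apply/setP=> z; rewrite [RHS]inE; apply/bigcupP.
  have /bigcupP[y _ zg] : z \in \bigcup_d g d by rewrite gT inE.
  have /bigcupP[x _ yf] : y \in \bigcup_d f d by rewrite fT inE.
  by exists x => //; apply: mem_shop_comp zg.
move=> R a c aR ac.
(* An intermediate tuple, chosen coordinatewise; the default is never taken, since [c] is reached
   from [a] in every coordinate. *)
pose b j := odflt (tnth a j) [pick y in f (tnth a j) | tnth c j \in g y].
have bP j : (b j \in f (tnth a j)) && (tnth c j \in g (b j)).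
  rewrite /b; case: pickP => [y //|none].
  by have /bigcupP[y yf cg] := ac j; move: (none y); rewrite yf cg.
apply: (gR R [tuple b j | j < _]) => [|j]; last first.
  by rewrite tnth_mktuple; case/andP: (bP j).
by apply: (fR R a) => // j; rewrite tnth_mktuple; case/andP: (bP j).
Qed.

Lemma U_surjective_comp (T : finType) (U V : {set T}) (f g : T -> {set T}) :
    V \subset setwise_image f U -> U_surjective V g ->
  U_surjective U (shop_comp f g).
Proof.
move=> /subsetP sVf gV; apply/setP=> z; rewrite [RHS]inE.
have /bigcupP[y yV zg] : z \in setwise_image g V by rewrite gV inE.
have /bigcupP[x xU yf] := sVf y yV.
by apply/bigcupP; exists x => //; apply: mem_shop_comp zg.
Qed.

Lemma X_total_comp (T : finType) (X Y : {set T}) (f g : T -> {set T}) :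
    X_total X f -> {in X, forall x, g x :&: Y != set0} ->
  X_total Y (shop_comp f g).
Proof.
move=> fX gY d; have /set0Pn[x /setIP[xf xX]] := fX d.
have /set0Pn[y /setIP[yg yY]] := gY x xX.
by apply/set0Pn; exists y; rewrite inE yY andbT (mem_shop_comp xf yg).
Qed.

(** * Bijections cut out by a relation *)

Definition graph_bij (T : finType) (p : rel T) (A B : {set T}) (a a' : T -> T) :
    Prop :=
  [/\ {in A, forall x, a x \in B}, {in B, forall y, a' y \in A},
      {in A, cancel a a'}, {in B, cancel a' a} &
      {in A & B, forall x y, p x y = (y == a x)}].

Lemma graph_bij_sym (T : finType) (p q : rel T) (A B : {set T}) (a a' : T -> T) :
  (forall x y, p x y = q y x) -> graph_bij p A B a a' -> graph_bij q B A a' a.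
Proof.
move=> pq [aB aA aK aK' pa]; split=> // y x yB xA.
by rewrite -pq pa //; apply/eqP/eqP=> ->; rewrite ?aK ?aK'.
Qed.

Lemma graph_bij_sub (T : finType) (p : rel T) (A B : {set T}) (a a' : T -> T) :
  graph_bij p A B a a' -> {in A, forall x, p x (a x)}.
Proof. by move=> [aB _ _ _ pa] x xA; rewrite pa ?aB. Qed.

(* If every transversal of the neighbourhoods of A has at least #|A| elements,
   then every choice of neighbours is injective; hence neighbourhoods are
   disjoint, and A and B are perfectly matched in a unique way. *)
Lemma graph_bij_transversal (T : finType) (p : rel T) (A B : {set T}) :
    #|A| = #|B| -> {in A, forall x, exists2 y, y \in B & p x y} ->
    (forall V : {set T}, {in A, forall x, exists2 y, y \in V & p x y} ->
       #|A| <= #|V|) ->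
  exists a a', graph_bij p A B a a'.
Proof.
move=> cAB exB minV.
pose a x := odflt x [pick y in B | p x y].
have aP x : x \in A -> (a x \in B) && p x (a x).
  move=> xA; rewrite /a; case: pickP => [y //|none].
  by have [y yB pxy] := exB x xA; move: (none y); rewrite yB pxy.
(* The image of [A] under a choice of neighbours is a transversal, so it has at least [#|A|]
   elements. *)
have choice_inj c : {in A, forall x, p x (c x)} -> {in A &, injective c}.
  move=> pc; apply/imset_injP; rewrite eqn_leq leq_imset_card /=.
  by apply: minV => x xA; exists (c x); rewrite ?imset_f ?pc.
have a_inj : {in A &, injective a}.
  by apply: choice_inj => x /aP /andP[].
have p_inj x x' y : x \in A -> x' \in A -> p x y -> p x' y -> x = x'.
  move=> xA x'A pxy px'y.
  (* Sending everything related to [y] to [y] itself is again a choice of neighbours, and it takes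
     the same value at [x] and [x']. *)
  apply: (choice_inj (fun z => if p z y then y else a z)) => //; last first.
    by rewrite pxy px'y.
  by move=> z /aP /andP[_ pza]; case: ifP.
have imA : a @: A = B.
  apply/eqP; rewrite eqEcard card_in_imset // cAB leqnn andbT.
  by apply/subsetP=> _ /imsetP[x /aP/andP[aB _] ->].
pose a' y := odflt y [pick x in A | a x == y].
have a'P y : y \in B -> (a' y \in A) && (a (a' y) == y).
  rewrite -imA => /imsetP[x xA ->]; rewrite /a'.
  by case: pickP => [z //|/(_ x)]; rewrite xA eqxx.
exists a, a'; split.
- by move=> x /aP /andP[].
- by move=> y /a'P /andP[].
- move=> x xA; have /andP[axB _] := aP x xA.
  by have /andP[zA /eqP] := a'P _ axB; apply: a_inj.
- by move=> y /a'P /andP[_ /eqP].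
move=> x y xA yB; apply/idP/eqP=> [pxy|->]; last by case/andP: (aP x xA).
have /andP[zA /eqP zy] := a'P y yB; rewrite -[LHS]zy; congr a.
apply/esym/(p_inj x (a' y) y) => //.
by have /andP[_] := aP _ zA; rewrite zy.
Qed.

(** The product of the orders of the two permutations is a common period, and it is positive. *)
Lemma injective_common_period (T : finType) (f g : T -> T) :
    injective f -> injective g ->
  exists n, iter n.+1 f =1 id /\ iter n.+1 g =1 id.
Proof.
move=> fI gI; pose s := perm fI; pose t := perm gI.
have [n nE] : exists n, n.+1 = #[s]%g * #[t]%g.
  by exists (#[s]%g * #[t]%g).-1; rewrite prednK // muln_gt0 !order_gt0.
have iterE (h : T -> T) (hI : injective h) x : (perm hI ^+ n.+1)%g x = iter n.+1 h x.
  by rewrite permX; apply: eq_iter => y; rewrite permE.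
exists n; split=> x; rewrite -?(iterE f fI x) -?(iterE g gI x) nE.
  by rewrite expgM expg_order expg1n perm1.
by rewrite mulnC expgM expg_order expg1n perm1.
Qed.

Definition link (T : finType) (p : T -> {set T}) : rel T :=
  fun x y => y \in p x.

(** * Bijections between two optimal choices *)

Section Matching.

Variables (sg : signature) (D : structure sg).
Implicit Types (U X : {set D}) (p q : D -> {set D}).

Lemma min_card_eq (T : finType) (P : {set T} -> Prop) (A B : {set T}) :
  min_card P A -> min_card P B -> #|A| = #|B|.
Proof. by move=> [PA mA] [PB mB]; apply/eqP; rewrite eqn_leq mA ?mB. Qed.

(** The transversal lemma applies to the reversed link: if each point of [U'] is reached from [V],
    then [p] followed by a [U']-surjective map is [V]-surjective, so [V] is no smaller than [U']. *)
Lemma U_surjective_bij U U' p :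
    min_card (@has_U_surjective_she sg D) U ->
    min_card (@has_U_surjective_she sg D) U' -> she p -> U_surjective U p ->
  exists a a', graph_bij (link p) U U' a a'.
Proof.
move=> mU mU' shp pU.
case: (@graph_bij_transversal _ (fun y x => link p x y) U' U).
- exact: min_card_eq mU' mU.
- move=> y _; have /bigcupP[x xU yp] : y \in setwise_image p U.
    by rewrite pU inE.
  by exists x.
- move=> V hV; case: mU' => -[h [shh hU']] minU'; apply: minU'.
  exists (shop_comp p h); split; first exact: she_comp.
  apply: U_surjective_comp hU'; apply/subsetP=> y /hV[x xV yp].
  by apply/bigcupP; exists x.
by move=> a' [a ba]; exists a, a'; apply: graph_bij_sym ba.
Qed.

(** Dually, if [p] leads from each point of [X] into [V], then an [X]-total map followed by [p] is
    [V]-total. *)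
Lemma X_total_bij X X' p :
    min_card (@has_X_total_she sg D) X ->
    min_card (@has_X_total_she sg D) X' -> she p -> X_total X' p ->
  exists b b', graph_bij (link p) X X' b b'.
Proof.
move=> mX mX' shp pX'; apply: graph_bij_transversal.
- exact: min_card_eq mX mX'.
- by move=> x _; have /set0Pn[y /setIP[yp yX']] := pX' x; exists y.
move=> V hV; case: mX => -[h [shh hX]] minX; apply: minX.
exists (shop_comp h p); split; first exact: she_comp.
apply: X_total_comp hX _ => x /hV[y yV yp].
by apply/set0Pn; exists y; rewrite inE yV andbT.
Qed.

Lemma she_U_surjective_setT p : she p -> U_surjective [set: D] p.
Proof.
move=> [[_ pT] _]; rewrite /U_surjective -{2}pT.
by apply: eq_bigl => z; rewrite inE.
Qed.

(** The first factor of a composite secures surjectivity from [U], the last one totality for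
    [X']. *)
Lemma min_UX_she U U' X X' :
    min_UX U X -> min_UX U' X' ->
  exists p, [/\ she p, U_surjective U p & X_total X' p].
Proof.
move=> [[[f [shf fU]] _] _] [_ [[g [shg gX']] _]].
exists (shop_comp f g); split; first exact: she_comp.
  apply: (U_surjective_comp (V := [set: D])); first by rewrite fU.
  exact: she_U_surjective_setT.
by apply: (X_total_comp (X := [set: D])) => // d; rewrite setIT shf.1.1.
Qed.

(** The round trip on [A] is extended by the identity, so that it becomes a permutation of the whole
    type and has a finite order. *)
Lemma graph_bij_shift_inj (T : finType) (p q : rel T) (A B : {set T})
    (a a' c c' : T -> T) :
    graph_bij p A B a a' -> graph_bij q B A c c' ->
  injective (fun z => if z \in A then c (a z) else z).
Proof.
move=> [aB _ aK _ _] [cA _ cK _ _]; apply: (can_inj (g := fun z =>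
  if z \in A then a' (c' z) else z)) => z /=.
have [zA|/negPf zA] := boolP (z \in A); last by rewrite zA.
by rewrite cA ?aB // cK ?aB // aK.
Qed.

(** Between [B] and [A] the relation [q] is the graph of [c] alone, so containing all pairs
    [(a x, x)] forces [c] to agree with [a'] on [B]. *)
Lemma graph_bij_unique (T : finType) (q : rel T) (A B : {set T})
    (a a' c c' : T -> T) :
    graph_bij q B A c c' ->
    {in A, forall x, a x \in B} -> {in B, forall y, a' y \in A} ->
    {in A, cancel a a'} -> {in B, cancel a' a} ->
    {in A, forall x, q (a x) x} ->
  graph_bij q B A a' a.
Proof.
move=> [cA _ _ _ qc] aB a'A aK a'K qa; split=> // y x yB xA.
rewrite qc //; suff -> : c y = a' y by [].
by apply/esym/eqP; rewrite -qc ?a'A // -{1}(a'K y yB) qa ?a'A.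
Qed.

Lemma exists_inverse_she U U' X X' p a a' b b' :
    min_UX U X -> min_UX U' X' -> she p ->
    graph_bij (link p) U U' a a' -> graph_bij (link p) X X' b b' ->
  exists q, [/\ she q, graph_bij (link q) U' U a' a
              & graph_bij (link q) X' X b' b].
Proof.
move=> mUX mUX' shp bijU bijX.
have [q0 [shq0 q0U' q0X]] := min_UX_she mUX' mUX.
have [c [c' bijc]] := U_surjective_bij mUX'.1 mUX.1 shq0 q0U'.
have [d [d' bijd]] := X_total_bij mUX'.2 mUX.2 shq0 q0X.
have sI := graph_bij_shift_inj bijU bijc.
have tI := graph_bij_shift_inj bijX bijd.
set s := (fun z => _) in sI; set t := (fun z => _) in tI.
have [aU' a'U aK a'K pa] := bijU; have [bX' b'X bK b'K pb] := bijX.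
have [cU _ _ _ qc] := bijc; have [dX _ _ _ qd] := bijd.
have sU n u : u \in U -> iter n s u \in U.
  by move=> uU; elim: n => //= n IHn; rewrite {1}/s IHn cU ?aU'.
have tX n x : x \in X -> iter n t x \in X.
  by move=> xX; elim: n => //= n IHn; rewrite {1}/t IHn dX ?bX'.
have stepU u : u \in U -> s u \in q0 (a u).
  by move=> uU; rewrite /s uU; apply: (graph_bij_sub bijc); apply: aU'.
have stepX x : x \in X -> t x \in q0 (b x).
  by move=> xX; rewrite /t xX; apply: (graph_bij_sub bijd); apply: bX'.
have pU := graph_bij_sub bijU; have pX := graph_bij_sub bijX.
(* The map is [q0] followed by [n] passes through [p] and then [q0]; [q0] alone already completes
   one round trip, hence [n.+1]. *)
have turns n : exists q, [/\ she q, U_surjective U' q, X_total X q,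
    {in U, forall u, iter n.+1 s u \in q (a u)} &
    {in X, forall x, iter n.+1 t x \in q (b x)}].
  elim: n => [|n [q [shq qU' qX qs qt]]]; first by exists q0.
  have shpq := she_comp shp shq0.
  exists (shop_comp q (shop_comp p q0)); split.
  - exact: she_comp.
  - by apply: (U_surjective_comp (V := [set: D])); rewrite ?qU' //; apply: she_U_surjective_setT.
  - apply: X_total_comp qX _ => x _.
    by apply: (X_total_comp (X := [set: D])) => // e; rewrite setIT shp.1.1.
  - move=> u uU; apply: mem_shop_comp (qs u uU) _.
    by apply: mem_shop_comp (pU _ (sU n.+1 u uU)) (stepU _ (sU n.+1 u uU)).
  move=> x xX; apply: mem_shop_comp (qt x xX) _.
  by apply: mem_shop_comp (pX _ (tX n.+1 x xX)) (stepX _ (tX n.+1 x xX)).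
(* A common period lets a single [q] invert [a] and [b] at once. *)
have [n [sn tn]] := injective_common_period sI tI.
have [q [shq qU' qX qs qt]] := turns n.
have [e [e' bije]] := U_surjective_bij mUX'.1 mUX.1 shq qU'.
have [g [g' bijg]] := X_total_bij mUX'.2 mUX.2 shq qX.
exists q; split=> //.
  by apply: graph_bij_unique bije _ _ _ _ _ => // u /qs; rewrite sn.
by apply: graph_bij_unique bijg _ _ _ _ _ => // x /qt; rewrite tn.
Qed.

Lemma graph_bij_agree U U' X X' p q a a' b b' :
    UX_choice U' X' -> she p -> she q ->
    graph_bij (link p) U U' a a' -> graph_bij (link p) X X' b b' ->
    graph_bij (link q) U' U a' a -> graph_bij (link q) X' X b' b ->
  forall x, x \in U -> x \in X -> a x = b x.
Proof.
move=> [[mU' mX'] maxUX'] shp shq bijU bijX bijU' bijX' x xU xX.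
have [aU' a'U aK a'K pa] := bijU; have [bX' b'X bK b'K pb] := bijX.
have pax := graph_bij_sub bijU; have pbx := graph_bij_sub bijX xX.
have qax := graph_bij_sub bijU'.
have qbx : x \in q (b x).
  by have := graph_bij_sub bijX' (bX' x xX); rewrite bK.
apply/eqP/negPn/negP => neq_ab.
have bxU' : b x \notin U'.
  apply: contra neq_ab => bxU'.
  by rewrite eq_sym -pa //.
pose U2 := b x |: (U' :\ a x).
have cU2 : #|U2| = #|U'|.
  by rewrite cardsU1 !inE (negPf bxU') andbF (cardsD1 (a x) U') aU'.
have U2P : has_U_surjective_she U2.
  have [[h [shh hU']] _] := mU'.
  (* From [U2], [q] followed by [p] covers [U']: [a x] is reached from [b x] through [x], and any
     other [u] from itself through [a' u]. *)
  exists (shop_comp (shop_comp q p) h); split.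
    by do 2?apply: she_comp.
  apply: U_surjective_comp hU'; apply/subsetP=> u uU'; apply/bigcupP.
  have [->|neq_u] := eqVneq u (a x).
    by exists (b x); rewrite ?inE ?eqxx //; apply: mem_shop_comp qbx (pax x xU).
  exists u; first by rewrite !inE neq_u uU' orbT.
  apply: mem_shop_comp (qax u uU') _.
  by have := pax _ (a'U u uU'); rewrite a'K.
have := maxUX' U2 X'; rewrite leqNgt => /(_ _) /negP; apply.
  by split=> //; split=> // B /(mU'.2); rewrite cU2.
apply: proper_card; apply/properP; split; last first.
  by exists (b x); rewrite !inE ?eqxx ?bX' // (negPf bxU').
(* The removed point [a x] is not in [X']: otherwise [p], being the graph of [b] there, would give
   [a x = b x]. *)
apply/subsetP=> z /setIP[zU' zX']; rewrite !inE zU' zX' !andbT.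
apply/orP; right; apply: contra neq_ab => /eqP za.
by rewrite -pb -?za //; rewrite za; apply: pax.
Qed.

(** A selection from a hyper-endomorphism preserves relations: [h] does so through [p], and its
    inverse [k] through [q]. *)
Lemma induced_isomorphic (S S' : {set D}) (S0 : S != set0) (S0' : S' != set0)
    p q (h k : D -> D) :
    she p -> she q ->
    {in S, forall x, h x \in S'} -> {in S', forall y, k y \in S} ->
    {in S, cancel h k} -> {in S', cancel k h} ->
    {in S, forall x, h x \in p x} -> {in S', forall y, k y \in q y} ->
  isomorphic (induced S0) (induced S0').
Proof.
move=> shp shq hS' kS hK kK hp kq.
pose H (x : induced S0) : induced S0' := Sub (h (val x)) (hS' _ (valP x)).
pose K (y : induced S0') : induced S0 := Sub (k (val y)) (kS _ (valP y)).
have HK : cancel H K by move=> x; apply: val_inj; rewrite /= hK ?(valP x).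
have KH : cancel K H by move=> y; apply: val_inj; rewrite /= kK ?(valP y).
exists H; split; first by exists K.
move=> R t; rewrite !inE; apply/idP/idP => tR.
  by apply: (shp.2 _ _ _ tR) => j; rewrite !tnth_map hp ?(valP (tnth t j)).
apply: (shq.2 _ _ _ tR) => j; rewrite !tnth_map.
by have := kq _ (valP (H (tnth t j))); rewrite /= hK ?(valP (tnth t j)).
Qed.

End Matching.

Theorem theorem4 (sg : signature) (D C1 C2 : structure sg) :
  UX_core D C1 -> UX_core D C2 -> isomorphic C1 C2.
Proof.
case=> U X cUX [U' X' cUX'].
have mUX := cUX.1; have mUX' := cUX'.1.
have [p [shp pU pX']] := min_UX_she mUX mUX'.
have [a [a' bijU]] := U_surjective_bij mUX.1 mUX'.1 shp pU.
have [b [b' bijX]] := X_total_bij mUX.2 mUX'.2 shp pX'.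
have [q [shq bijU' bijX']] := exists_inverse_she mUX mUX' shp bijU bijX.
have ab := graph_bij_agree cUX' shp shq bijU bijX bijU' bijX'.
have ab' := graph_bij_agree cUX shq shp bijU' bijX' bijU bijX.
have [aU' a'U aK a'K pa] := bijU; have [bX' b'X bK b'K pb] := bijX.
(* By [ab] and [ab'], the preference for [U] and [U'] is harmless: [h] is [b] on all of [X], and [k]
   is [b'] on all of [X']. *)
pose h z := if z \in U then a z else b z.
pose k z := if z \in U' then a' z else b' z.
have hU z : z \in U -> h z = a z by rewrite /h => ->.
have kU z : z \in U' -> k z = a' z by rewrite /k => ->.
have hX z : z \in X -> h z = b z.
  by rewrite /h; case: ifP => // zU zX; apply: ab.
have kX z : z \in X' -> k z = b' z.
  by rewrite /k; case: ifP => // zU zX; apply: ab'.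
apply: (@induced_isomorphic _ _ _ _ _ _ p q h k) => //.
- by move=> z /setUP[zU|zX]; rewrite inE; [rewrite hU ?aU' | rewrite hX ?bX' ?orbT].
- by move=> z /setUP[zU|zX]; rewrite inE; [rewrite kU ?a'U | rewrite kX ?b'X ?orbT].
- move=> z /setUP[zU|zX]; first by rewrite hU // kU ?aU' ?aK.
  by rewrite hX // kX ?bX' ?bK.
- move=> z /setUP[zU|zX]; first by rewrite kU // hU ?a'U ?a'K.
  by rewrite kX // hX ?b'X ?b'K.
- move=> z /setUP[zU|zX].
    by rewrite hU //; apply: (graph_bij_sub bijU).
  by rewrite hX //; apply: (graph_bij_sub bijX).
move=> z /setUP[zU|zX].
  by rewrite kU //; apply: (graph_bij_sub bijU').
by rewrite kX //; apply: (graph_bij_sub bijX').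
Qed.
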